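(* Let $\alpha,\beta$ be dual curves $I\to\mathbb{D}^3$ with dual Frenet frames $\{T,N,B\}$ and $\{\overline T,\overline N,\overline B\}$ respectively, and let $\Phi$ be the dual angle between the dual Darboux vector $W$ of $\alpha$ and the dual unit binormal vector $B$ of $\alpha$. If the dual curve $\beta$ is an involute of the dual curve $\alpha$, then the dual Frenet vectors of $\alpha$ and $\beta$ are related by $$\overline T=N,\qquad \overline N=-\cos\Phi\,T+\sin\Phi\,B,\qquad \overline B=\sin\Phi\,T+\cos\Phi\,B .$$
   Context: $\mathbb{D}=\{a+\varepsilon a^*: a,a^*\in\mathbb{R}\}$, $\varepsilon^2=0$, is the commutative ring of dual numbers. $\mathbb{D}^3=\{\vec a+\varepsilon\vec a^*:\vec a,\vec a^*\in\mathbb{R}^3\}$ is the corresponding $\mathbb{D}$-module, with inner product $\langle \vec a+\varepsilon\vec a^*,\vec b+\varepsilon\vec b^*\rangle=\langle\vec a,\vec b\rangle+\varepsilon(\langle\vec a,\vec b^*\rangle+\langle\vec a^*,\vec b\rangle)$, vector product $(\vec a+\varepsilon\vec a^* )\wedge(\vec b+\varepsilon\vec b^* )=\vec a\wedge\vec b+\varepsilon(\vec a\wedge\vec b^*+\vec a^*\wedge\vec b)$ and, when $\vec a\neq0$, norm $\|\vec a+\varepsilon\vec a^*\|=\|\vec a\|+\varepsilon\langle\vec a,\vec a^*\rangle/\|\vec a\|$. A dual curve is a differentiable map $I\subset\mathbb{R}\to\mathbb{D}^3$; derivatives in $s$ are taken in the real and dual parts separately. For a unit speed dual curve $\alpha$,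 the dual Frenet frame $\{T,N,B\}$ consists of the dual tangent, principal normal and binormal; the dual curvature $\kappa=\sqrt{\langle T',T'\rangle}$ and dual torsion $\tau$ satisfy $T'=\kappa N$, $N'=-\kappa T+\tau B$, $B'=-\tau N$. The Darboux vector of $\alpha$ is $W=\tau T+\kappa B$. The Frenet vectors of $\beta$ are $\overline T=\beta'/\|\beta'\|$, $\overline B=(\beta'\wedge\beta'')/\|\beta'\wedge\beta''\|$, $\overline N=\overline B\wedge\overline T$. Involute: let $\alpha,\beta:I\to\mathbb{D}^3$ be dual unit speed curves with tangents $T$ and $\overline T$. If the tangent lines of $\alpha$ are orthogonal to the tangent lines of $\beta$, that is, $\langle T,\overline T\rangle=0$, then $\beta$ is called an involute of $\alpha$. An involute is written $\beta(s)=\alpha(s)+\lambda(s)T(s)$ with $\lambda(s)=(c_1-s)+\varepsilon c_2$, $c_1,c_2\in\mathbb{R}$, where $s$ is the arc parameter of $\alpha$. The dual angle $\Phi=\varphi+\varepsilon\varphi^*$ between $W$ and $B$ satisfies $\sin\Phi=\dfrac{\tau}{\sqrt{\kappa^2+\tau^2}}$, $\cos\Phi=\dfrac{\kappa}{\sqrt{\kappa^2+\tau^2}}$, where $\sin\Phi=\sin\varphi+\varepsilon\varphi^*\cos\varphi$ and $\cos\Phi=\cos\varphi-\varepsilon\varphi^*\sin\varphi$.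
   Formalization: The identities for the tangent and principal normal of β are stated only for s < c1: for s > c1, β' = λκN with negative real factor, so both get the opposite sign and the claim fails; the binormal identity is stated for all s. *)

(* Defs.v *)
From HB Require Import structures.
From mathcomp Require Import all_boot all_order all_algebra.
From mathcomp Require Import ring.
From mathcomp Require Import all_classical all_reals all_analysis.

Set Implicit Arguments.
Unset Strict Implicit.
Unset Printing Implicit Defensive.
Set Warnings "-redundant-canonical-projection".

Import Order.TTheory GRing.Theory Num.Theory.
Import numFieldNormedType.Exports.

Local Open Scope classical_set_scope.
Local Open Scope ring_scope.

(* [Dual a a'] is the dual number a + eps a', with eps ^ 2 = 0. *)
Record dualnum (R : Type) := Dual { dre : R; ddu : R }.

Definition pair_of_dual (R : Type) (x : dualnum R) : R * R := (dre x, ddu x).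
Definition dual_of_pair (R : Type) (p : R * R) : dualnum R := Dual p.1 p.2.

Lemma pair_of_dualK (R : Type) : cancel (@pair_of_dual R) (@dual_of_pair R).
Proof. by case. Qed.

HB.instance Definition _ (R : choiceType) :=
  Choice.copy (dualnum R) (can_type (@pair_of_dualK R)).

Section DualRing.
Variable R : fieldType.
Implicit Types x y z : dualnum R.

Definition dual0 : dualnum R := Dual 0 0.
Definition dual_opp x := Dual (- dre x) (- ddu x).
Definition dual_add x y := Dual (dre x + dre y) (ddu x + ddu y).
Definition dual1 : dualnum R := Dual 1 0.
Definition dual_mul x y :=
  Dual (dre x * dre y) (dre x * ddu y + ddu x * dre y).

Definition dual_unit : {pred dualnum R} := fun x => dre x != 0.

(* On non-units the inverse is the identity, the convention of unitRingType. *)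
Definition dual_inv x :=
  if dre x == 0 then x else Dual (dre x)^-1 (- ddu x / dre x ^+ 2).

Lemma dual_addA : associative dual_add.
Proof. by move=> [a a'] [b b'] [c c']; congr Dual; rewrite /= addrA. Qed.
Lemma dual_addC : commutative dual_add.
Proof. by move=> [a a'] [b b']; congr Dual; rewrite /= addrC. Qed.
Lemma dual_add0 : left_id dual0 dual_add.
Proof. by move=> [a a']; congr Dual; rewrite /= add0r. Qed.
Lemma dual_addN : left_inverse dual0 dual_opp dual_add.
Proof. by move=> [a a']; congr Dual; rewrite /= addNr. Qed.

HB.instance Definition _ := GRing.isZmodule.Build (dualnum R)
  dual_addA dual_addC dual_add0 dual_addN.

Lemma dual_mulA : associative dual_mul.
Proof. by move=> [a a'] [b b'] [c c']; congr Dual => /=; ring. Qed.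
Lemma dual_mulC : commutative dual_mul.
Proof. by move=> [a a'] [b b']; congr Dual => /=; ring. Qed.
Lemma dual_mul1 : left_id dual1 dual_mul.
Proof. by move=> [a a']; congr Dual => /=; ring. Qed.
Lemma dual_mulDl : left_distributive dual_mul dual_add.
Proof. by move=> [a a'] [b b'] [c c']; congr Dual => /=; ring. Qed.
Lemma dual1_neq0 : dual1 != dual0.
Proof. by apply/eqP => -[] /eqP; rewrite oner_eq0. Qed.

HB.instance Definition _ := GRing.Zmodule_isComNzRing.Build (dualnum R)
  dual_mulA dual_mulC dual_mul1 dual_mulDl dual1_neq0.

Lemma dual_mulV : {in dual_unit, left_inverse 1 dual_inv *%R}.
Proof.
move=> [a a']; rewrite unfold_in /dual_unit /dual_inv /= => a0.
by rewrite (negbTE a0); congr Dual => /=; field.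
Qed.
Lemma dual_unitP x y : y * x = 1 -> dual_unit x.
Proof.
case: x y => [a a'] [b b'] [ba _]; apply/eqP => /= a0.
by move/eqP: ba; rewrite a0 mulr0 eq_sym oner_eq0.
Qed.
Lemma dual_inv_out : {in [predC dual_unit], dual_inv =1 id}.
Proof.
by move=> x; rewrite inE unfold_in /dual_unit negbK /dual_inv => ->.
Qed.

HB.instance Definition _ := GRing.ComNzRing_hasMulInverse.Build (dualnum R)
  dual_mulV dual_unitP dual_inv_out.

End DualRing.

(* The D-module D^3, represented by row vectors of dual numbers;
   [dvec a a'] is the dual vector a + eps a'. *)
Notation dual3 R := 'rV[dualnum R]_3.

Section DualVectors.
Variable R : realType.
Implicit Types (a b : 'rV[R]_3) (u v : dual3 R) (x : dualnum R).

Definition dvec a b : dual3 R := \row_i Dual (a 0 i) (b 0 i).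
Definition vre u : 'rV[R]_3 := map_mx (@dre R) u.
Definition vdu u : 'rV[R]_3 := map_mx (@ddu R) u.

Definition rdot a b : R := \sum_i a 0 i * b 0 i.

(* The Euclidean norm: the library norm on row vectors is the sup norm. *)
Definition rnorm a : R := Num.sqrt (rdot a a).

(* Indices are added in 'I_3, that is, modulo 3. *)
Definition rcross a b : 'rV[R]_3 :=
  \row_(i < 3) (a 0 (i + 1) * b 0 (i + 2) - a 0 (i + 2) * b 0 (i + 1)).

Definition ddot u v : dualnum R :=
  Dual (rdot (vre u) (vre v)) (rdot (vre u) (vdu v) + rdot (vdu u) (vre v)).

Definition dcross u v : dual3 R :=
  dvec (rcross (vre u) (vre v))
       (rcross (vre u) (vdu v) + rcross (vdu u) (vre v)).

(* Meaningful only when [vre u != 0]. *)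
Definition dnorm u : dualnum R :=
  Dual (rnorm (vre u)) (rdot (vre u) (vdu u) / rnorm (vre u)).

(* First-order Taylor extension of the square root,
   meaningful only when [0 < dre x]. *)
Definition dsqrt x : dualnum R :=
  Dual (Num.sqrt (dre x)) (ddu x / (2 * Num.sqrt (dre x))).

Definition dsin x : dualnum R := Dual (sin (dre x)) (ddu x * cos (dre x)).
Definition dcos x : dualnum R := Dual (cos (dre x)) (- (ddu x * sin (dre x))).

End DualVectors.
Arguments vre {R} u.
Arguments vdu {R} u.

Section DualCurves.
Variable R : realType.
Implicit Types (I : set R) (g alpha beta : R -> dual3 R) (s : R).

Definition dderive g : R -> dual3 R :=
  fun s => dvec (derive1 (vre \o g) s) (derive1 (vdu \o g) s).

Definition dderivable g s : Prop :=
  derivable (vre \o g) s 1 /\ derivable (vdu \o g) s 1.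

(* [g] is [n] times differentiable on [I] (meant for [I] open). *)
Definition dual_curve (n : nat) I g : Prop :=
  forall k, (k < n)%N -> forall s, I s -> dderivable (iter k dderive g) s.

(* The nondegeneracy that makes the Frenet frame of [g] exist on [I]: the real
   part of g' /\ g'' does not vanish, hence neither does the real part of g'. *)
Definition has_frenet_frame I g : Prop :=
  forall s, I s -> vre (dcross (dderive g s) (dderive (dderive g) s)) != 0.

Definition unit_speed I g : Prop :=
  forall s, I s -> dnorm (dderive g s) = 1.

(* Frenet apparatus of a unit speed curve; [torsion] is the coefficient of
   the binormal in N' = - kappa T + tau B. *)
Definition unit_tangent alpha : R -> dual3 R := dderive alpha.

Definition curvature alpha s : dualnum R :=
  let T' := dderive (unit_tangent alpha) s in dsqrt (ddot T' T').

Definition principal_normal alpha s : dual3 R :=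
  (curvature alpha s)^-1 *: dderive (unit_tangent alpha) s.

Definition unit_binormal alpha s : dual3 R :=
  dcross (unit_tangent alpha s) (principal_normal alpha s).

Definition torsion alpha s : dualnum R :=
  ddot (dderive (principal_normal alpha) s) (unit_binormal alpha s).

Definition darboux alpha s : dual3 R :=
  torsion alpha s *: unit_tangent alpha s
  + curvature alpha s *: unit_binormal alpha s.

(* Frenet vectors of a curve with arbitrary parameter. *)
Definition gtangent beta s : dual3 R :=
  (dnorm (dderive beta s))^-1 *: dderive beta s.

Definition gbinormal beta s : dual3 R :=
  let w := dcross (dderive beta s) (dderive (dderive beta) s) in
  (dnorm w)^-1 *: w.

Definition gnormal beta s : dual3 R :=
  dcross (gbinormal beta s) (gtangent beta s).

(* [beta] is the involute of the unit speed curve [alpha] with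
   lambda(s) = (c1 - s) + eps c2; both curves carry the parameter [s],
   which is the arc length of [alpha] but not of [beta]. *)
Definition involute I alpha beta (c1 c2 : R) : Prop :=
  (forall s, I s -> ddot (unit_tangent alpha s) (gtangent beta s) = 0) /\
  (forall s, I s ->
     beta s = alpha s + Dual (c1 - s) c2 *: unit_tangent alpha s).

(* [Phi s] is the dual angle between the Darboux vector and the binormal; the
   sine fixes its orientation, which the inner product leaves undetermined. *)
Definition darboux_angle I alpha (Phi : R -> dualnum R) : Prop :=
  forall s, I s ->
    let W := darboux alpha s in
    let B := unit_binormal alpha s in
    let kappa := curvature alpha s in
    let tau := torsion alpha s in
    [/\ ddot W B = dnorm W * dnorm B * dcos (Phi s),
        dsin (Phi s) = tau / dsqrt (kappa ^+ 2 + tau ^+ 2)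
      & dcos (Phi s) = kappa / dsqrt (kappa ^+ 2 + tau ^+ 2)].

End DualCurves.

(* Main.v *)
(* Differentiating beta = alpha + lambda T, with lambda' = -1, gives
   beta' = lambda T' and beta'' = lambda T'' - T'.  Hence beta' is parallel to
   N, and beta' /\ beta'' = lambda^2 T' /\ T'' = lambda^2 kappa^2 W is parallel
   to the Darboux vector W, for which ||W||^2 = kappa^2 + tau^2.  Normalizing a
   dual vector is insensitive to scaling by dual numbers with positive real part. *)
Require Import Defs.
From mathcomp Require Import all_boot all_order all_algebra.
From mathcomp Require Import ring lra.
From mathcomp Require Import all_classical all_reals all_analysis.

Import Order.TTheory GRing.Theory Num.Theory.
Import numFieldNormedType.Exports.
Local Open Scope classical_set_scope.
Local Open Scope ring_scope.

(** * Algebra of dual numbers and dual vectors *)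

Section DualAlgebra.
Set Implicit Arguments.
Unset Strict Implicit.
Context {R : realType}.
Implicit Types (x y : dualnum R) (u v w : dual3 R) (a b : 'rV[R]_3).

Lemma dualP x y : dre x = dre y -> ddu x = ddu y -> x = y.
Proof. by case: x y => [a a'] [b b'] /= -> ->. Qed.

Lemma dreM x y : dre (x * y) = dre x * dre y.
Proof. by []. Qed.

Lemma dreD x y : dre (x + y) = dre x + dre y.
Proof. by []. Qed.

Lemma dreX x n : dre (x ^+ n) = dre x ^+ n.
Proof. by elim: n => // n IHn; rewrite !exprS dreM IHn. Qed.

Lemma dual_unitE x : (x \is a GRing.unit) = (dre x != 0).
Proof. by []. Qed.

Lemma dual_invE x :
  x^-1 = if dre x == 0 then x else Dual (dre x)^-1 (- ddu x / dre x ^+ 2).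
Proof. by []. Qed.

Lemma row3P {A : Type} (u v : 'rV[A]_3) :
  u 0 0 = v 0 0 -> u 0 1 = v 0 1 -> u 0 2 = v 0 2 -> u = v.
Proof.
move=> h0 h1 h2; apply/rowP => -[[|[|[|//]]] lt_i].
- by rewrite (_ : Ordinal lt_i = 0); last exact/val_inj.
- by rewrite (_ : Ordinal lt_i = 1); last exact/val_inj.
- by rewrite (_ : Ordinal lt_i = 2); last exact/val_inj.
Qed.

Lemma rdotE a b : rdot a b = a 0 0 * b 0 0 + a 0 1 * b 0 1 + a 0 2 * b 0 2.
Proof.
rewrite /rdot !big_ord_recr big_ord0 /= add0r.
by congr (a 0 _ * b 0 _ + a 0 _ * b 0 _ + a 0 _ * b 0 _); apply/val_inj.
Qed.

Lemma ddotE u v : ddot u v = u 0 0 * v 0 0 + u 0 1 * v 0 1 + u 0 2 * v 0 2.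
Proof.
by apply: dualP; rewrite /ddot !rdotE /vre /vdu !mxE /=; ring.
Qed.

Lemma dcrossE u v i :
  dcross u v 0 i = u 0 (i + 1) * v 0 (i + 2) - u 0 (i + 2) * v 0 (i + 1).
Proof. by apply: dualP; rewrite !mxE /=; ring. Qed.

Lemma vre_dcross u v : vre (dcross u v) = rcross (vre u) (vre v).
Proof. by apply/rowP => i; rewrite [LHS]mxE [dcross u v 0 i]mxE. Qed.

Lemma rcrossv0 a : rcross a 0 = 0.
Proof. by apply/rowP => i; rewrite !mxE !mulr0 subrr. Qed.

Lemma dcross0 u v : dcross u v 0 0 = u 0 1 * v 0 2 - u 0 2 * v 0 1.
Proof. by rewrite dcrossE !add0r. Qed.

Lemma dcross1 u v : dcross u v 0 1 = u 0 2 * v 0 0 - u 0 0 * v 0 2.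
Proof.
by rewrite dcrossE; congr (u 0 _ * v 0 _ - u 0 _ * v 0 _); apply/val_inj.
Qed.

Lemma dcross2 u v : dcross u v 0 2 = u 0 0 * v 0 1 - u 0 1 * v 0 0.
Proof.
by rewrite dcrossE; congr (u 0 _ * v 0 _ - u 0 _ * v 0 _); apply/val_inj.
Qed.

(** Together with [mxE], these rules turn an identity in D^3 into polynomial identities between dual
    coordinates, which [ring] settles in the commutative ring D. *)
Definition dvecE := (ddotE, dcross0, dcross1, dcross2).

Lemma ddotC u v : ddot u v = ddot v u.
Proof. by rewrite !ddotE; ring. Qed.

Lemma ddotDl u v w : ddot (u + v) w = ddot u w + ddot v w.
Proof. by rewrite !ddotE !mxE; ring. Qed.

Lemma ddotZl x u v : ddot (x *: u) v = x * ddot u v.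
Proof. by rewrite !ddotE !mxE; ring. Qed.

Lemma ddotDr u v w : ddot w (u + v) = ddot w u + ddot w v.
Proof. by rewrite !ddotE !mxE; ring. Qed.

Lemma ddotZr x u v : ddot v (x *: u) = x * ddot v u.
Proof. by rewrite !ddotE !mxE; ring. Qed.

Lemma dcrossDr u v w : dcross w (u + v) = dcross w u + dcross w v.
Proof. by apply: row3P; rewrite [RHS]mxE !dvecE !mxE; ring. Qed.

Lemma dcrossDl u v w : dcross (u + v) w = dcross u w + dcross v w.
Proof. by apply: row3P; rewrite [RHS]mxE !dvecE !mxE; ring. Qed.

Lemma dcrossZr x u v : dcross v (x *: u) = x *: dcross v u.
Proof. by apply: row3P; rewrite [RHS]mxE !dvecE !mxE; ring. Qed.

Lemma dcrossZl x u v : dcross (x *: u) v = x *: dcross u v.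
Proof. by apply: row3P; rewrite [RHS]mxE !dvecE !mxE; ring. Qed.

Lemma dcrossC u v : dcross u v = - dcross v u.
Proof. by apply: row3P; rewrite [RHS]mxE !dvecE; ring. Qed.

Lemma dcrossvv u : dcross u u = 0.
Proof. by apply: row3P; rewrite [RHS]mxE !dvecE; ring. Qed.

(** The shape of beta' /\ beta'', with [u = T'], [v = T''], [x = lambda]; the term [- u] only
    contributes a multiple of u /\ u = 0. *)
Lemma dcrossZB x u v : dcross (x *: u) (x *: v - u) = x ^+ 2 *: dcross u v.
Proof.
rewrite -scaleN1r dcrossDr dcrossZl !dcrossZr dcrossZl dcrossvv !scaler0 addr0.
by rewrite scalerA.
Qed.

Lemma ddot_dcrossl u v : ddot u (dcross u v) = 0.
Proof. by rewrite !dvecE; ring. Qed.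

Lemma ddot_dcrossr u v : ddot v (dcross u v) = 0.
Proof. by rewrite !dvecE; ring. Qed.

(** Lagrange's identity, over D. *)
Lemma ddot_dcross u v :
  ddot (dcross u v) (dcross u v) = ddot u u * ddot v v - ddot u v ^+ 2.
Proof. by rewrite !dvecE; ring. Qed.

(** Grassmann's expansion of the double vector product, over D. *)
Lemma dcross_dcross u v w :
  dcross u (dcross v w) = ddot u w *: v - ddot u v *: w.
Proof. by apply: row3P; rewrite ![in RHS]mxE !dvecE; ring. Qed.

Lemma scale_comb z x y u v :
  z *: (x *: u + y *: v) = (x * z) *: u + (y * z) *: v.
Proof. by rewrite scalerDr !scalerA !(mulrC z). Qed.

(** The sum arises by differentiating [ddot T T = 1]. It is twice [ddot u v], and the factor 2 is
    cancelled in the real and dual parts. *)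
Lemma ddot_sym_eq0 u v : ddot u v + ddot v u = 0 -> ddot u v = 0.
Proof.
rewrite (ddotC v u); case: (ddot u v) => x x' [x0 x'0].
by apply: dualP => /=; lra.
Qed.

Lemma ddot_comb x y u v w : ddot v w = 0 ->
  ddot (x *: u + y *: v) w = x * ddot u w.
Proof. by move=> vw; rewrite ddotDl !ddotZl vw mulr0 addr0. Qed.

Section Orthonormal.
Variables (t n : dual3 R).
Hypotheses (tt : ddot t t = 1) (nn : ddot n n = 1) (tn : ddot t n = 0).
Let b := dcross t n.

Lemma ddot_binormal : ddot b b = 1.
Proof. by rewrite ddot_dcross tt nn tn expr0n subr0 mulr1. Qed.

Lemma dcross_tangent_binormal : dcross t b = - n.
Proof. by rewrite dcross_dcross tn tt scale0r scale1r sub0r. Qed.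

Lemma dcross_binormal_normal : dcross b n = - t.
Proof.
by rewrite dcrossC dcross_dcross nn (ddotC n) tn scale0r scale1r subr0.
Qed.

(* As [n = b /\ t], expanding a double product gives the components of [n /\ u]. *)
Lemma dcross_normal x y u : ddot t u = - x ^+ 2 -> ddot u b = x * y ->
  dcross (x *: n) u = x ^+ 2 *: (y *: t + x *: b).
Proof.
move=> tu ub; rewrite -[n]opprK -dcross_tangent_binormal -scaleN1r !dcrossZl.
rewrite dcrossC dcross_dcross ub (ddotC u) tu.
by apply/rowP => i; rewrite !mxE; ring.
Qed.

(** Gives the squared norm of W, for [x = tau] and [y = kappa]. *)
Lemma ddot_comb_binormal x y :
  ddot (x *: t + y *: b) (x *: t + y *: b) = y ^+ 2 + x ^+ 2.
Proof.
rewrite !ddotDl !ddotDr !ddotZl !ddotZr tt ddot_binormal (ddotC b t).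
by rewrite ddot_dcrossl; ring.
Qed.

(** Serves to compute the normal of beta, with [x], [y] the sine and cosine of the Darboux angle: t
    /\ n is [b] itself and b /\ n = -t. *)
Lemma dcross_comb_normal x y :
  dcross (x *: t + y *: b) n = - y *: t + x *: b.
Proof.
by rewrite dcrossDl !dcrossZl dcross_binormal_normal scalerN addrC scaleNr.
Qed.

End Orthonormal.

(** * Norms and square roots in D *)

Lemma rdot_gt0 a : a != 0 -> 0 < rdot a a.
Proof.
move=> a_neq0; rewrite lt_def sumr_ge0 => [|i _]; last exact: sqr_ge0.
rewrite andbT; apply: contra_neq a_neq0 => /eqP.
rewrite psumr_eq0 => [/allP a0|i _]; last exact: sqr_ge0.
apply/rowP => i; rewrite mxE; apply/eqP.
by have := a0 i (mem_index_enum i); rewrite mulf_eq0 orbb.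
Qed.

(** For u = a + eps a', the dual part of the root has numerator 2<a,a'> and denominator 2|a|.
    Properties of the norm thereby reduce to those of [dsqrt]. *)
Lemma dnormE u : dnorm u = dsqrt (ddot u u).
Proof.
apply: dualP => //=; rewrite invfM mulrA; congr (_ / _).
rewrite (_ : rdot (vdu u) (vre u) = rdot (vre u) (vdu u)); last first.
  by rewrite !rdotE; ring.
by field.
Qed.

(** Once the real norm is 1, the dual part of the norm is <a,a'> itself, half the dual part of
    [ddot u u]. *)
Lemma dnorm1_ddot u : dnorm u = 1 -> ddot u u = 1.
Proof.
case=> norm_u; rewrite norm_u divr1 => dot_u0.
apply: dualP => /=.
  have dot_ge0 : 0 <= rdot (vre u) (vre u) by apply: sumr_ge0 => i _; exact: sqr_ge0.
  by rewrite -(sqr_sqrtr dot_ge0) -/(rnorm _) norm_u expr1n.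
by move: dot_u0; rewrite !rdotE => dot_u0; lra.
Qed.

Lemma sqr_dsqrt x : 0 < dre x -> dsqrt x ^+ 2 = x.
Proof.
move=> x0; have sx0 : Num.sqrt (dre x) != 0 by rewrite gt_eqF ?sqrtr_gt0.
apply: dualP; rewrite expr2 /=; first by rewrite -expr2 sqr_sqrtr // ltW.
by field.
Qed.

Lemma dsqrt_sqr x : 0 < dre x -> dsqrt (x ^+ 2) = x.
Proof.
move=> x0; apply: dualP => /=; first by rewrite sqrtr_sqr gtr0_norm.
rewrite -expr2 sqrtr_sqr gtr0_norm //.
by field; rewrite gt_eqF.
Qed.

(** Both factors are squares of their roots, so the product is the square of a dual number with
    positive real part. *)
Lemma dsqrtM x y : 0 < dre x -> 0 < dre y ->
  dsqrt (x * y) = dsqrt x * dsqrt y.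
Proof.
move=> x0 y0.
have sqrt_gt0 (z : dualnum R) : 0 < dre z -> 0 < dre (dsqrt z) by rewrite /= sqrtr_gt0.
rewrite -{1}(sqr_dsqrt x0) -{1}(sqr_dsqrt y0) -exprMn dsqrt_sqr // dreM.
by rewrite mulr_gt0 ?sqrt_gt0.
Qed.

Lemma dnorm1 u : ddot u u = 1 -> dnorm u = 1.
Proof. by rewrite dnormE => ->; rewrite -{1}(expr1n _ 2) dsqrt_sqr ?ltr01. Qed.

Lemma dnormZ x u : 0 < dre x -> 0 < dre (ddot u u) ->
  dnorm (x *: u) = x * dnorm u.
Proof.
move=> x0 u0; rewrite !dnormE ddotZl ddotZr mulrA -expr2 dsqrtM ?dreX ?exprn_gt0 //.
by rewrite dsqrt_sqr.
Qed.

(** The scalar leaves the norm unchanged and cancels as a unit; a negative real part would instead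
    reverse the direction. *)
Lemma normalizeZ x u : 0 < dre x -> 0 < dre (ddot u u) ->
  (dnorm (x *: u))^-1 *: (x *: u) = (dnorm u)^-1 *: u.
Proof.
move=> x0 u0; have x_unit : x \is a GRing.unit by rewrite dual_unitE gt_eqF.
have u_unit : dnorm u \is a GRing.unit.
  by rewrite dual_unitE gt_eqF // dnormE sqrtr_gt0.
by rewrite dnormZ // scalerA invrM // divrK.
Qed.

End DualAlgebra.

(** * Differentiation of dual functions and dual curves *)

Section DualDerivatives.
Set Implicit Arguments.
Unset Strict Implicit.
Context {R : realType}.
Implicit Types (s t : R) (f h : R -> dualnum R) (g k : R -> dual3 R).

(** As with [is_derive], existence and value are asserted together, so that the rules below chain
    without separate differentiability goals. *)
Definition is_dual_derive f s (l : dualnum R) : Prop :=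
  is_derive s 1 (fun t => dre (f t)) (dre l) /\
  is_derive s 1 (fun t => ddu (f t)) (ddu l).

Definition is_dvec_derive g s (l : dual3 R) : Prop :=
  forall i, is_dual_derive (fun t => g t 0 i) s (l 0 i).

Lemma derive1_coord (a : R -> 'rV[R]_3) s i : derivable a s 1 ->
  derive1 a s 0 i = 'D_1 (fun t => a t 0 i) s.
Proof. by move=> da; rewrite derive1E derive_mx // mxE. Qed.

Lemma vre_coord g i : (fun t => (vre \o g) t 0 i) = (fun t => dre (g t 0 i)).
Proof. by apply/funext => t; rewrite mxE. Qed.

Lemma vdu_coord g i : (fun t => (vdu \o g) t 0 i) = (fun t => ddu (g t 0 i)).
Proof. by apply/funext => t; rewrite mxE. Qed.

Lemma dderive_coord g s i : dderivable g s -> dderive g s 0 i =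
  Dual ('D_1 (fun t => dre (g t 0 i)) s) ('D_1 (fun t => ddu (g t 0 i)) s).
Proof.
move=> [dre_g ddu_g]; rewrite [LHS]mxE.
by rewrite !derive1_coord // vre_coord vdu_coord.
Qed.

Lemma dderivableP g s : dderivable g s -> is_dvec_derive g s (dderive g s).
Proof.
move=> dg i; rewrite dderive_coord //; case: dg => dre_g ddu_g.
split; apply: derivableP.
- by rewrite -vre_coord; move/derivable_mxP: dre_g; apply.
- by rewrite -vdu_coord; move/derivable_mxP: ddu_g; apply.
Qed.

Lemma is_dvec_derive_dderivable g s l : is_dvec_derive g s l -> dderivable g s.
Proof.
move=> dg; split; apply/derivable_mxP => j i; rewrite ord1.
- by rewrite vre_coord; case: (dg i) => -[].
- by rewrite vdu_coord; case: (dg i) => _ [].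
Qed.

Lemma dderive_val g s l : is_dvec_derive g s l -> dderive g s = l.
Proof.
move=> dg; apply/rowP => i; rewrite dderive_coord.
  by have [[_ d1] [_ d2]] := dg i; apply: dualP.
exact: is_dvec_derive_dderivable dg.
Qed.

Lemma is_dual_derive_unique f s l l' :
  is_dual_derive f s l -> is_dual_derive f s l' -> l = l'.
Proof.
by move=> [[_ d1] [_ d2]] [[_ e1] [_ e2]]; apply: dualP; rewrite -?d1 -?d2.
Qed.

(** Identities along the curves are known only on the open set [I], hence near each of its points;
    locality lets them be differentiated. *)
Lemma near_eq_is_dual_derive f h s l : (\near s, f s = h s) ->
  is_dual_derive f s l -> is_dual_derive h s l.
Proof.
by move=> fh [df1 df2]; split; [apply: near_eq_is_derive df1|
  apply: near_eq_is_derive df2]; apply: filterS fh => t ->.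
Qed.

Lemma near_eq_is_dvec_derive g k s l : (\near s, g s = k s) ->
  is_dvec_derive g s l -> is_dvec_derive k s l.
Proof.
move=> gk dg i; apply: near_eq_is_dual_derive (dg i).
by apply: filterS gk => t ->.
Qed.

Lemma is_dual_derive_cst (x : dualnum R) s : is_dual_derive (fun=> x) s 0.
Proof. by split; exact: is_derive_cst. Qed.

Lemma is_dual_deriveD f h s l l' : is_dual_derive f s l ->
  is_dual_derive h s l' -> is_dual_derive (fun t => f t + h t) s (l + l').
Proof.
by move=> [df1 df2] [dh1 dh2]; split; [exact: (is_deriveD df1 dh1)|
  exact: (is_deriveD df2 dh2)].
Qed.

Lemma is_dual_deriveM f h s l l' : is_dual_derive f s l ->
  is_dual_derive h s l' ->
  is_dual_derive (fun t => f t * h t) s (f s * l' + l * h s).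
Proof.
move=> [df1 df2] [dh1 dh2]; split.
  apply: is_derive_eq (is_deriveM df1 dh1) _.
  by rewrite /= /GRing.scale /=; ring.
(* The dual part of a product is a sum of two real products, so two real Leibniz rules are added. *)
apply: is_derive_eq (is_deriveD (is_deriveM df1 dh2) (is_deriveM df2 dh1)) _.
by rewrite /= /GRing.scale /=; ring.
Qed.

Lemma is_dvec_deriveD g k s l l' : is_dvec_derive g s l ->
  is_dvec_derive k s l' -> is_dvec_derive (fun t => g t + k t) s (l + l').
Proof.
move=> dg dk i; rewrite mxE; under eq_fun do rewrite mxE.
exact: is_dual_deriveD.
Qed.

Lemma is_dvec_deriveZ f g s l l' : is_dual_derive f s l ->
  is_dvec_derive g s l' ->
  is_dvec_derive (fun t => f t *: g t) s (f s *: l' + l *: g s).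
Proof.
move=> df dg i; rewrite !mxE; under eq_fun do rewrite mxE.
exact: is_dual_deriveM.
Qed.

Lemma is_dual_derive_ddot g k s l l' : is_dvec_derive g s l ->
  is_dvec_derive k s l' ->
  is_dual_derive (fun t => ddot (g t) (k t)) s (ddot (g s) l' + ddot l (k s)).
Proof.
move=> dg dk; under eq_fun do rewrite ddotE.
rewrite (_ : ddot _ _ + ddot _ _ =
  (g s 0 0 * l' 0 0 + l 0 0 * k s 0 0) + (g s 0 1 * l' 0 1 + l 0 1 * k s 0 1) +
  (g s 0 2 * l' 0 2 + l 0 2 * k s 0 2)); last by rewrite !ddotE; ring.
by apply: is_dual_deriveD; [apply: is_dual_deriveD|]; exact: is_dual_deriveM.
Qed.

(* Valid for every [x]: when [dre x <= 0] both sides are 0, as [0^-1 = 0]. *)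
Lemma dsqrtVE (x : dualnum R) : (dsqrt x)^-1 =
  Dual (Num.sqrt (dre x))^-1 (- (ddu x / 2) * (Num.sqrt (dre x))^-1 ^+ 3).
Proof.
rewrite dual_invE [dre (dsqrt x)]/= [ddu (dsqrt x)]/=.
case: eqP => [x0|/eqP sx0].
  by apply: dualP => /=; rewrite x0 invr0 ?mulr0 ?invr0 ?expr0n ?mulr0.
by apply: dualP => //=; field.
Qed.

(** By [dsqrtVE], both parts are polynomial in [ddu (f t)] and the inverse root of [dre (f t)]. The
    value stays existential: in N' it only multiplies T', which is orthogonal to B. *)
Lemma is_dual_derive_dsqrtV f s l : is_dual_derive f s l -> 0 < dre (f s) ->
  exists l', is_dual_derive (fun t => (dsqrt (f t))^-1) s l'.
Proof.
move=> [df1 df2] f0.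
rewrite (funext (fun t => dsqrtVE (f t))).
have sf0 : Num.sqrt (dre (f s)) != 0 by rewrite gt_eqF ?sqrtr_gt0.
have dsf := is_derive1_comp (is_derive1_sqrt f0) df1.
have dV := @is_deriveV R (Num.sqrt \o (fun t => dre (f t))) s _ 1 sf0 dsf.
have dh := is_deriveM (is_deriveN (is_deriveM df2 (is_derive_cst (2^-1 : R) s 1)))
  (is_deriveX 3 dV).
eexists (Dual _ _); split; first exact: dV.
exact: dh.
Qed.

End DualDerivatives.

(** * Frenet apparatus of the unit speed curve alpha *)

Section FrenetFrame.
Set Implicit Arguments.
Unset Strict Implicit.
Context {R : realType}.
Variables (I : set R) (alpha : R -> dual3 R).
Hypotheses (open_I : open I) (alpha_curve : dual_curve 3 I alpha).
Hypotheses (alpha_unit_speed : unit_speed I alpha)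
  (alpha_frame : has_frenet_frame I alpha).
Implicit Types s t : R.

Local Notation T := (unit_tangent alpha).
Local Notation T' := (dderive T).
Local Notation T'' := (dderive T').
Local Notation N := (principal_normal alpha).
Local Notation B := (unit_binormal alpha).
Local Notation kappa := (curvature alpha).
Local Notation tau := (torsion alpha).

Let near_I s : I s -> \near s, I s.
Proof. by move=> Is; apply: open_nbhs_nbhs. Qed.

Lemma unit_tangent_derive s : I s -> is_dvec_derive alpha s (T s).
Proof. by move=> Is; apply: dderivableP; exact: (alpha_curve (isT : (0 < 3)%N) Is). Qed.

Lemma unit_tangent_derive1 s : I s -> is_dvec_derive T s (T' s).
Proof. by move=> Is; apply: dderivableP; exact: (alpha_curve (isT : (1 < 3)%N) Is). Qed.

Lemma unit_tangent_derive2 s : I s -> is_dvec_derive T' s (T'' s).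
Proof. by move=> Is; apply: dderivableP; exact: (alpha_curve (isT : (2 < 3)%N) Is). Qed.

Lemma ddot_TT s : I s -> ddot (T s) (T s) = 1.
Proof. by move=> Is; apply: dnorm1_ddot; exact: alpha_unit_speed. Qed.

Lemma ddot_TT' s : I s -> ddot (T s) (T' s) = 0.
Proof.
move=> Is; have dT := unit_tangent_derive1 Is.
have dTT : is_dual_derive (fun t => ddot (T t) (T t)) s 0.
  apply: near_eq_is_dual_derive (is_dual_derive_cst 1 s).
  by apply: filterS (near_I Is) => t It; rewrite (ddot_TT It).
exact: ddot_sym_eq0 (is_dual_derive_unique (is_dual_derive_ddot dT dT) dTT).
Qed.

(** Differentiate <T,T'> = 0, which holds near [s]. *)
Lemma ddot_TT'' s : I s -> ddot (T s) (T'' s) = - ddot (T' s) (T' s).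
Proof.
move=> Is; have dT := unit_tangent_derive1 Is.
have dTT : is_dual_derive (fun t => ddot (T t) (T' t)) s 0.
  apply: near_eq_is_dual_derive (is_dual_derive_cst 0 s).
  by apply: filterS (near_I Is) => t It; rewrite (ddot_TT' It).
have := is_dual_derive_ddot dT (unit_tangent_derive2 Is).
by move/(is_dual_derive_unique dTT)/esym/eqP; rewrite addr_eq0 => /eqP.
Qed.

(** Were the real part of T' zero, so would be that of alpha' /\ alpha'' = T /\ T', against
    [alpha_frame]. *)
Lemma ddot_T'T'_gt0 s : I s -> 0 < dre (ddot (T' s) (T' s)).
Proof.
move=> Is; apply: rdot_gt0; apply: contra_neq (alpha_frame Is) => T'0.
by apply: etrans (vre_dcross (T s) (T' s)) _; rewrite [X in rcross _ X]T'0 rcrossv0.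
Qed.

Lemma curvature_gt0 s : I s -> 0 < dre (kappa s).
Proof. by move=> Is; rewrite sqrtr_gt0; exact: ddot_T'T'_gt0. Qed.

Lemma curvature_unit s : I s -> kappa s \is a GRing.unit.
Proof. by move=> Is; rewrite dual_unitE (gt_eqF (curvature_gt0 Is)). Qed.

Lemma curvature_sqr s : I s -> kappa s ^+ 2 = ddot (T' s) (T' s).
Proof. by move=> Is; exact: sqr_dsqrt (ddot_T'T'_gt0 Is). Qed.

Lemma dderive_T s : I s -> T' s = kappa s *: N s.
Proof. by move=> Is; rewrite scalerA (divrr (curvature_unit Is)) scale1r. Qed.

Lemma ddot_TN s : I s -> ddot (T s) (N s) = 0.
Proof. by move=> Is; rewrite ddotZr (ddot_TT' Is) mulr0. Qed.

Lemma ddot_NN s : I s -> ddot (N s) (N s) = 1.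
Proof.
move=> Is; rewrite ddotZl ddotZr -(curvature_sqr Is) expr2.
by rewrite (mulKr (curvature_unit Is)) (mulVr (curvature_unit Is)).
Qed.

Lemma ddot_T'B s : I s -> ddot (T' s) (B s) = 0.
Proof. by move=> Is; rewrite (dderive_T Is) ddotZl ddot_dcrossr mulr0. Qed.

(** From N = kappa^-1 T' comes N' = kappa^-1 T'' + l T'. Pairing with B kills the second term,
    whence tau = kappa^-1 <T'',B>. *)
Lemma ddot_T''B s : I s -> ddot (T'' s) (B s) = kappa s * tau s.
Proof.
move=> Is; have [l dkV] := is_dual_derive_dsqrtV
  (is_dual_derive_ddot (unit_tangent_derive2 Is) (unit_tangent_derive2 Is))
  (ddot_T'T'_gt0 Is).
have dN : dderive N s = (kappa s)^-1 *: T'' s + l *: T' s.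
  (* [dkV] concerns the unfolded form of kappa^-1, so it applies to N by conversion. *)
  exact: dderive_val (is_dvec_deriveZ dkV (unit_tangent_derive2 Is)).
rewrite /torsion dN (ddot_comb _ _ _ (ddot_T'B Is)).
by rewrite (mulVKr (curvature_unit Is)).
Qed.

(** This is [dcross_normal] with [x = kappa], [y = tau]. The N component of T'' is lost in the
    product, so the derivative of kappa never has to be computed. *)
Lemma dcross_T'T'' s : I s ->
  dcross (T' s) (T'' s) = kappa s ^+ 2 *: darboux alpha s.
Proof.
move=> Is; rewrite [X in dcross X _](dderive_T Is).
apply: (dcross_normal (ddot_TT Is) (ddot_TN Is)); last exact: ddot_T''B Is.
by rewrite (ddot_TT'' Is) (curvature_sqr Is).
Qed.

Lemma ddot_darboux s : I s ->
  ddot (darboux alpha s) (darboux alpha s) = kappa s ^+ 2 + tau s ^+ 2.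
Proof.
move=> Is; exact: ddot_comb_binormal (ddot_TT Is) (ddot_NN Is) (ddot_TN Is) _ _.
Qed.

Lemma ddot_darboux_gt0 s : I s -> 0 < dre (ddot (darboux alpha s) (darboux alpha s)).
Proof.
move=> Is; rewrite (ddot_darboux Is) dreD !dreX ltr_pwDl ?sqr_ge0 //.
exact: exprn_gt0 (curvature_gt0 Is).
Qed.

(** * Frenet vectors of the involute *)

Section Involute.
Variables (beta : R -> dual3 R) (c1 c2 : R).
Hypothesis beta_frame : has_frenet_frame I beta.
Hypothesis beta_involute : involute I alpha beta c1 c2.

Let lambda s : dualnum R := Dual (c1 - s) c2.

Lemma lambda_derive s : is_dual_derive lambda s (-1).
Proof.
split; last by rewrite /= oppr0; exact: is_derive_cst.
apply: is_derive_eq (is_deriveB (is_derive_cst c1 s 1) (is_derive_id s 1)) _.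
by rewrite /= sub0r.
Qed.

Lemma dderive_involute s : I s -> dderive beta s = lambda s *: T' s.
Proof.
move=> Is; have dl := lambda_derive s; have dT := unit_tangent_derive1 Is.
(* The product rule yields alpha' = T and, from lambda' = -1, a term -T; the two cancel. *)
have -> : lambda s *: T' s = T s + (lambda s *: T' s + -1 *: T s).
  by rewrite scaleN1r addrCA subrr addr0.
apply/dderive_val/near_eq_is_dvec_derive/(is_dvec_deriveD
  (unit_tangent_derive Is) (is_dvec_deriveZ dl dT)).
by apply: filterS (near_I Is) => t /beta_involute.2.
Qed.

Lemma dderive2_involute s : I s ->
  dderive (dderive beta) s = lambda s *: T'' s - T' s.
Proof.
move=> Is; rewrite -[- T' s]scaleN1r.
apply/dderive_val/near_eq_is_dvec_derive/(is_dvec_deriveZ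
  (lambda_derive s) (unit_tangent_derive2 Is)).
by apply: filterS (near_I Is) => t /dderive_involute.
Qed.

Lemma dcross_involute s : I s ->
  dcross (dderive beta s) (dderive (dderive beta) s) =
  lambda s ^+ 2 *: (kappa s ^+ 2 *: darboux alpha s).
Proof.
move=> Is; rewrite (dderive2_involute Is) (dderive_involute Is) dcrossZB.
by rewrite (dcross_T'T'' Is).
Qed.

(** At [s = c1] the factor lambda^2 would annihilate the real part of beta' /\ beta''; [beta_frame]
    excludes this singular point. *)
Lemma lambda_neq0 s : I s -> dre (lambda s) != 0.
Proof.
move=> Is; apply: contra_neq (beta_frame Is) => l0.
rewrite (dcross_involute Is); apply/rowP => i; rewrite [LHS]mxE [RHS]mxE.
by rewrite [X in dre X]mxE dreM dreX l0 expr0n mul0r.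
Qed.

(** The factor lambda^2 kappa^2 has positive real part on either side of [c1], so no order between
    [s] and [c1] is assumed. *)
Lemma gbinormal_involute s : I s -> gbinormal beta s =
  (dsqrt (kappa s ^+ 2 + tau s ^+ 2))^-1 *: darboux alpha s.
Proof.
move=> Is; rewrite /gbinormal (dcross_involute Is) scalerA normalizeZ.
- by rewrite dnormE (ddot_darboux Is).
- rewrite dreM !dreX mulr_gt0 //; last exact: exprn_gt0 (curvature_gt0 Is).
  by rewrite exprn_even_gt0 //=; exact: lambda_neq0.
- exact: ddot_darboux_gt0.
Qed.

(** Here the factor is lambda kappa, whose real part has the sign of [c1 - s]; past [c1] the tangent
    would be -N. *)
Lemma gtangent_involute s : I s -> s < c1 -> gtangent beta s = N s.
Proof.
move=> Is lt_s_c1; rewrite /gtangent (dderive_involute Is).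
rewrite (dderive_T Is) scalerA normalizeZ.
- by rewrite (dnorm1 (ddot_NN Is)) invr1 scale1r.
- by rewrite dreM mulr_gt0 ?(curvature_gt0 Is) // subr_gt0.
- by rewrite (ddot_NN Is) ltr01.
Qed.

End Involute.
End FrenetFrame.

Theorem theorem2 (R : realType) (I : set R) (alpha beta : R -> dual3 R)
    (c1 c2 : R) (Phi : R -> dualnum R)
    (open_I : open I)
    (alpha_curve : dual_curve 3 I alpha)
    (beta_curve : dual_curve 2 I beta)
    (alpha_unit_speed : unit_speed I alpha)
    (alpha_frame : has_frenet_frame I alpha)
    (beta_frame : has_frenet_frame I beta)
    (PhiP : darboux_angle I alpha Phi)
    (beta_involute : involute I alpha beta c1 c2)
    (s : R) (Is : I s) :
  [/\ s < c1 -> gtangent beta s = principal_normal alpha s,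
      s < c1 -> gnormal beta s =
        - dcos (Phi s) *: unit_tangent alpha s
        + dsin (Phi s) *: unit_binormal alpha s
    & gbinormal beta s =
        dsin (Phi s) *: unit_tangent alpha s
        + dcos (Phi s) *: unit_binormal alpha s].
Proof.
have Bbar : gbinormal beta s = dsin (Phi s) *: unit_tangent alpha s
    + dcos (Phi s) *: unit_binormal alpha s.
  (* Sine and cosine become tau and kappa over the dual norm of W, so the claim is the normalized
     Darboux vector in components. *)
  have [_ -> ->] := PhiP s Is.
  rewrite (gbinormal_involute open_I alpha_curve alpha_unit_speed alpha_frame
    beta_frame beta_involute Is).
  exact: scale_comb.
have Tbar := gtangent_involute open_I alpha_curve alpha_frame beta_involute Is.
split; [exact: Tbar| |exact: Bbar] => lt_s_c1.
(* The normal inherits the condition [s < c1] from the tangent, being the product of binormal and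
   tangent. *)
rewrite /gnormal Bbar (Tbar lt_s_c1).
exact: dcross_comb_normal (ddot_NN alpha_frame Is)
  (ddot_TN open_I alpha_curve alpha_unit_speed Is) _ _.
Qed.
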